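(* Let $G(u)=H(P_\Omega(Q(u)))$ be as described in the context, with Lipschitz constants $c_Q,c_H$, contraction factor $c=c_Hc_Q<1$, and fixed point $u^*$; let $F(u)=G(u)-u$. Suppose that $\bar c:=\frac{2c-c^2}{1-c}<1$. Then for every $\hat c\in(\bar c,1)$ there exists $\delta_0>0$ such that for every $u_0\in D$ with $\|u_0-u^*\|\le\delta_0$, any sequence $\{u_k\}$ generated by EDIIS(1) from $u_0$ satisfies $$\|F(u_{k+1})\|\le \hat c\,\|F(u_k)\|,\qquad k=0,1,2,\ldots.$$
   Context: $\|\cdot\|$ is the Euclidean norm (and the induced operator norm). $\Omega=\{w\in\mathbb{R}^l:\underline w\le w\le\overline w\}$ (componentwise) with $\underline w\in(\{-\infty\}\cup\mathbb{R})^l$, $\overline w\in(\mathbb{R}\cup\{\infty\})^l$, $\underline w<\overline w$ componentwise, and $P_\Omega$ is the Euclidean projection onto $\Omega$. $Q:\mathbb{R}^n\to\mathbb{R}^l$, $H:\mathbb{R}^l\to\mathbb{R}^n$, and $G(u):=H(P_\Omega(Q(u)))$. $D\subset\mathbb{R}^n$ is a closed set with $G(D)\subseteq D$. Standing assumptions: (i) $Q$ is continuously differentiable on $D$ with Lipschitz continuous derivative, and $Q$ is Lipschitz continuous on $D$ with constant $c_Q$; (ii) $H$ is continuously differentiable with Lipschitz continuous derivative on an open set $D_H\supseteq\Omega$, and $H$ is Lipschitz continuous on $D_H$ with constant $c_H$; (iii) $c:=c_Hc_Q<1$. Thus $G$ is a contraction on $D$ with factor $c$ and has a unique fixed point $u^*\in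 D$. It is assumed that there is $\delta>0$ such that the ball $\mathcal{B}(\delta,u^* )=\{u:\|u-u^*\|\le\delta\}$ is contained in $D$. EDIIS(1): given $u_0\in D$, set $u_1=G(u_0)$; for $k=1,2,\ldots$, with $F_k=F(u_k)=G(u_k)-u_k$, let $\alpha_k$ be a minimizer over $\alpha\in[0,1]$ of $\|(1-\alpha)F_k+\alpha F_{k-1}\|$, and set $u_{k+1}=(1-\alpha_k)G(u_k)+\alpha_kG(u_{k-1})$. *)

(* Defs.v *)
From HB Require Import structures.
From mathcomp Require Import all_boot all_order all_algebra.
From mathcomp Require Import all_classical all_reals all_analysis.

Set Implicit Arguments.
Unset Strict Implicit.
Unset Printing Implicit Defensive.

Import Order.TTheory GRing.Theory Num.Theory.
Import numFieldNormedType.Exports.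

Local Open Scope classical_set_scope.
Local Open Scope ring_scope.

(* R^n is 'rV[R]_n. The library's norm `|v| on it is the max norm, so the
   Euclidean norm and its induced operator norm are defined here. The topology
   (open, closed, differentiable, continuous) is the library's: it is the usual
   one, all norms on R^n being equivalent. *)
Definition enorm (R : realType) (n : nat) (v : 'rV[R]_n) : R :=
  Num.sqrt (\sum_(i < n) v ord0 i ^+ 2).

(* In the library's convention a matrix, in particular the Jacobian 'J f x,
   acts on row vectors by v |-> v *m A. *)
Definition opnorm (R : realType) (n m : nat) (A : 'M[R]_(n, m)) : R :=
  sup [set enorm (v *m A) | v in [set v : 'rV[R]_n | enorm v <= 1]].

Definition lipschitz_cst (R : realType) (n m : nat) (A : set 'rV[R]_n)
    (f : 'rV[R]_n -> 'rV[R]_m) (L : R) : Prop :=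
  0 <= L /\ forall x y, A x -> A y -> enorm (f x - f y) <= L * enorm (x - y).

(* Fréchet differentiability is that of f : R^n -> R^m at each point of A
   (two-sided also at boundary points of A); nothing is asked outside A. *)
Definition C1_lipschitz (R : realType) (n m : nat) (A : set 'rV[R]_n)
    (f : 'rV[R]_n -> 'rV[R]_m) : Prop :=
  [/\ forall x, A x -> differentiable f x,
      {within A, continuous (fun x => 'J f x)} &
      exists L : R, 0 <= L /\
        forall x y, A x -> A y -> opnorm ('J f x - 'J f y) <= L * enorm (x - y)].

Definition box (R : realType) (l : nat) (lo hi : 'rV[\bar R]_l) : set 'rV[R]_l :=
  [set w | forall i, (lo ord0 i <= (w ord0 i)%:E)%E /\ ((w ord0 i)%:E <= hi ord0 i)%E].

(* The nearest point of A to w; it exists and is unique when A is nonempty,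
   closed and convex. The default value w of xget is irrelevant then. *)
Definition eproj (R : realType) (l : nat) (A : set 'rV[R]_l) (w : 'rV[R]_l) :
    'rV[R]_l :=
  xget w [set p | A p /\ forall z, A z -> enorm (w - p) <= enorm (w - z)].

Definition residual (R : realType) (n : nat) (G : 'rV[R]_n -> 'rV[R]_n)
  (u : 'rV[R]_n) : 'rV[R]_n := G u - u.

Definition is_minimizer (R : realType) (A : set R) (f : R -> R) (a : R) : Prop :=
  A a /\ forall b, A b -> f a <= f b.

Definition EDIIS1 (R : realType) (n : nat) (G : 'rV[R]_n -> 'rV[R]_n)
    (u0 : 'rV[R]_n) (u : nat -> 'rV[R]_n) : Prop :=
  [/\ u 0%N = u0,
      u 1%N = G u0 &
      exists alpha : nat -> R, forall k : nat, (1 <= k)%N ->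
        is_minimizer `[0, 1]
          (fun a => enorm ((1 - a) *: residual G (u k)
                           + a *: residual G (u k.-1)))
          (alpha k) /\
        u k.+1 = (1 - alpha k) *: G (u k) + alpha k *: G (u k.-1)].

(* Main.v *)
Require Import Defs.
From HB Require Import structures.
From mathcomp Require Import all_boot all_order all_algebra.
From mathcomp Require Import all_classical all_reals all_analysis.
From mathcomp Require Import ring lra.

Set Implicit Arguments.
Unset Strict Implicit.
Unset Printing Implicit Defensive.

Import Order.TTheory GRing.Theory Num.Theory.
Import numFieldNormedType.Exports.

Local Open Scope classical_set_scope.
Local Open Scope ring_scope.

(** Let [u_(k+1)] be the mixture with weight [a] of [G u_k] and [G u_(k-1)],
    let [v] be the same mixture of [u_k] and [u_(k-1)], and write [F] for the
    residual [G u - u]. Then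
      [F u_(k+1) = (G u_(k+1) - G v) + (G v - u_(k+1))].
    Since [u_(k+1) - v] is the mixture of the two residuals, which minimality of
    [a] makes no longer than [F u_k], the first bracket is at most
    [c |F u_k|]. The second bracket is the defect of [G] from affine
    interpolation on the segment from [u_k] to [u_(k-1)], and everything rests
    on bounding it by [a (c + K d) d] with [d = |u_k - u_(k-1)|]
    ([composite_interpolation_defect]).

    The functions [Q] and [H], having Lipschitz derivatives, deviate from affine
    interpolation only by [O(a d^2)] ([interpolation_defect]). The projection
    onto the box is not differentiable, but it acts on each coordinate as a
    nondecreasing 1-Lipschitz function, and for such a function the defect is at
    most [a] times the length of the segment
    ([clamp_interpolation_defect]); mere Lipschitz continuity would give twice
    that, and hence a worse rate.

    To return from [d] to residuals, contractivity gives
    [(1 - c) d <= |F u_(k-1) - F u_k|], and the first order condition for the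
    minimizer, which holds in the needed direction also when [a] is constrained
    to [[0, 1]], gives [a |F u_(k-1) - F u_k| <= |F u_k|]
    ([is_minimizer_mix]). Altogether
      [|F u_(k+1)| <= (c + (c + K d) / (1 - c)) |F u_k|],
    where [c + c / (1 - c)] is exactly [cbar]. Mixtures with weights in
    [[0, 1]] keep all iterates in a small ball around the fixed point
    ([EDIIS1_ball]), so [K d] is as small as desired. The initial step from
    [u_0] to [G u_0] contracts residuals by [c], and [c <= cbar]. *)

(** * Euclidean norm *)

Definition dot (R : realType) (n : nat) (u v : 'rV[R]_n) : R :=
  \sum_(i < n) u ord0 i * v ord0 i.

Lemma dotC (R : realType) (n : nat) (u v : 'rV[R]_n) : dot u v = dot v u.
Proof. by apply: eq_bigr => i _; rewrite mulrC. Qed.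

Lemma dotDl (R : realType) (n : nat) (u v w : 'rV[R]_n) :
  dot (u + v) w = dot u w + dot v w.
Proof. by rewrite -big_split; apply: eq_bigr => i _; rewrite mxE mulrDl. Qed.

Lemma dotZl (R : realType) (n : nat) (a : R) (u w : 'rV[R]_n) :
  dot (a *: u) w = a * dot u w.
Proof. by rewrite mulr_sumr; apply: eq_bigr => i _; rewrite mxE mulrA. Qed.

Lemma dotNl (R : realType) (n : nat) (u w : 'rV[R]_n) : dot (- u) w = - dot u w.
Proof. by rewrite -scaleN1r dotZl mulN1r. Qed.

Lemma dotDr (R : realType) (n : nat) (u v w : 'rV[R]_n) :
  dot w (u + v) = dot w u + dot w v.
Proof. by rewrite dotC dotDl ![dot w _]dotC. Qed.

Lemma dotZr (R : realType) (n : nat) (a : R) (u w : 'rV[R]_n) :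
  dot w (a *: u) = a * dot w u.
Proof. by rewrite dotC dotZl [dot w _]dotC. Qed.

Lemma dotNr (R : realType) (n : nat) (u w : 'rV[R]_n) : dot w (- u) = - dot w u.
Proof. by rewrite dotC dotNl [dot w _]dotC. Qed.

Lemma dot_ge0 (R : realType) (n : nat) (u : 'rV[R]_n) : 0 <= dot u u.
Proof. by apply: sumr_ge0 => i _; rewrite -expr2 sqr_ge0. Qed.

Lemma enorm_ge0 (R : realType) (n : nat) (u : 'rV[R]_n) : 0 <= enorm u.
Proof. exact: sqrtr_ge0. Qed.

Lemma enorm_sqr (R : realType) (n : nat) (u : 'rV[R]_n) : enorm u ^+ 2 = dot u u.
Proof.
rewrite sqr_sqrtr; first by apply: eq_bigr => i _; rewrite expr2.
by apply: sumr_ge0 => i _; rewrite sqr_ge0.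
Qed.

Lemma enorm0 (R : realType) (n : nat) : enorm (0 : 'rV[R]_n) = 0.
Proof. by rewrite /enorm big1 ?sqrtr0// => i _; rewrite mxE expr0n. Qed.

Lemma enormZ (R : realType) (n : nat) (a : R) (u : 'rV[R]_n) :
  enorm (a *: u) = `|a| * enorm u.
Proof.
apply/eqP; rewrite -(@eqrXn2 _ 2) ?mulr_ge0 ?enorm_ge0//.
by rewrite exprMn !enorm_sqr dotZl dotZr mulrA -expr2 real_normK// num_real.
Qed.

Lemma enormN (R : realType) (n : nat) (u : 'rV[R]_n) : enorm (- u) = enorm u.
Proof. by rewrite -scaleN1r enormZ normrN1 mul1r. Qed.

Lemma enormBC (R : realType) (n : nat) (u v : 'rV[R]_n) :
  enorm (u - v) = enorm (v - u).
Proof. by rewrite -enormN opprB. Qed.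

Lemma enorm_eq0 (R : realType) (n : nat) (u : 'rV[R]_n) : enorm u = 0 -> u = 0.
Proof.
move=> u0; have /eqP := enorm_sqr u.
rewrite u0 expr0n eq_sym /dot psumr_eq0 => [/allP h|i _]; last first.
  by rewrite -expr2 sqr_ge0.
apply/rowP => i; rewrite mxE; apply/eqP.
by have := h i (mem_index_enum i); rewrite /= -expr2 sqrf_eq0.
Qed.

(** Cauchy-Schwarz, from the nonnegativity of the squared norm of
    [|v|^2 u - <u, v> v]. *)
Lemma dot_le_enorm (R : realType) (n : nat) (u v : 'rV[R]_n) :
  dot u v <= enorm u * enorm v.
Proof.
have [v0|v_neq0] := eqVneq (enorm v) 0.
  by rewrite v0 mulr0 (enorm_eq0 v0) -(scale0r (0 : 'rV[R]_n)) dotZr mul0r.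
have v_gt0 : 0 < enorm v by rewrite lt_def v_neq0 enorm_ge0.
rewrite (le_trans (ler_norm _))//.
rewrite -(@ler_pXn2r _ 2) ?nnegrE ?mulr_ge0 ?enorm_ge0//.
have := dot_ge0 (enorm v ^+ 2 *: u - dot u v *: v).
rewrite !(dotDl, dotDr, dotNl, dotNr, dotZl, dotZr) -!enorm_sqr (dotC v u).
set x := enorm u; set y := enorm v; set d := dot u v => h.
rewrite real_normK ?num_real// exprMn -subr_ge0.
have y2 : 0 < y ^+ 2 by rewrite exprn_gt0.
by rewrite -(pmulr_rge0 _ y2); move: h; congr (_ <= _); ring.
Qed.

Lemma ler_enormD (R : realType) (n : nat) (u v : 'rV[R]_n) :
  enorm (u + v) <= enorm u + enorm v.
Proof.
rewrite -(@ler_pXn2r _ 2) ?nnegrE ?addr_ge0 ?enorm_ge0//.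
rewrite enorm_sqr !(dotDl, dotDr) (dotC v u) sqrrD !enorm_sqr.
have := dot_le_enorm u v; lra.
Qed.

Lemma ler_enormB (R : realType) (n : nat) (u v : 'rV[R]_n) :
  enorm u - enorm v <= enorm (u - v).
Proof. by rewrite lerBlDr (le_trans _ (ler_enormD _ _))// subrK. Qed.

Lemma ler_enorm_conv (R : realType) (n : nat) (t : R) (u v : 'rV[R]_n) :
  0 <= t <= 1 ->
  enorm ((1 - t) *: u + t *: v) <= (1 - t) * enorm u + t * enorm v.
Proof.
move=> /andP[t0 t1]; rewrite (le_trans (ler_enormD _ _))// !enormZ.
by rewrite !ger0_norm ?subr_ge0.
Qed.

Lemma ler_enorm_coord (R : realType) (n : nat) (u v : 'rV[R]_n) :
  (forall i, `|u ord0 i| <= `|v ord0 i|) -> enorm u <= enorm v.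
Proof.
move=> uv; rewrite /enorm ler_wsqrtr// ler_sum// => i _.
rewrite -(real_normK (num_real (u _ _))) -(real_normK (num_real (v _ _))).
by rewrite lerXn2r ?nnegrE.
Qed.

(** What has to be shown is that the supremum defining [opnorm] is over a
    bounded set, since [sup] is meaningless otherwise: by Cauchy-Schwarz the
    [j]-th coordinate of [w *m A] with [enorm w <= 1] is bounded by the norm of
    the [j]-th column of [A]. *)
Lemma enorm_mulmx_le (R : realType) (n m : nat) (v : 'rV[R]_n) (A : 'M[R]_(n, m)) :
  enorm (v *m A) <= opnorm A * enorm v.
Proof.
have bnd : exists M, forall w : 'rV[R]_n, enorm w <= 1 -> enorm (w *m A) <= M.
  exists (enorm (\row_j enorm (\row_i A i j))) => w w1.
  apply: ler_enorm_coord => j; rewrite !mxE (ger0_norm (enorm_ge0 _)).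
  have -> : \sum_k w ord0 k * A k j = dot w (\row_i A i j).
    by apply: eq_bigr => k _; rewrite mxE.
  have dot_le (z : 'rV[R]_n) : enorm z <= 1 ->
    dot z (\row_i A i j) <= enorm (\row_i A i j).
    by move=> z1; rewrite (le_trans (dot_le_enorm _ _))// ler_piMl ?enorm_ge0.
  by rewrite ler_norml lerNl -dotNl !dot_le// enormN.
have [v0|v_neq0] := eqVneq (enorm v) 0.
  by rewrite (enorm_eq0 v0) mul0mx !enorm0 mulr0.
have v_gt0 : 0 < enorm v by rewrite lt_def v_neq0 enorm_ge0.
rewrite -ler_pdivrMr//.
have -> : enorm (v *m A) / enorm v = enorm (((enorm v)^-1 *: v) *m A).
  by rewrite -scalemxAl enormZ ger0_norm ?invr_ge0 ?enorm_ge0// mulrC.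
apply: ub_le_sup; last first.
  exists ((enorm v)^-1 *: v) => //=.
  by rewrite enormZ ger0_norm ?invr_ge0 ?enorm_ge0// mulVf.
have [M hM] := bnd.
by exists M => _ /= [w w1 <-]; exact: hM.
Qed.

(** * Affine interpolation of a function with Lipschitz derivative *)

Lemma differentiable_line (R : realType) (n m : nat) (f : 'rV[R]_n -> 'rV[R]_m)
    (x h : 'rV[R]_n) (t : R) :
  differentiable f (x + t *: h) ->
  differentiable (fun s : R => f (x + s *: h)) t /\
  'D_1 (fun s : R => f (x + s *: h)) t = h *m 'J f (x + t *: h).
Proof.
move=> df.
have da : is_diff t (cst x + (fun s : R => s *: h) : R -> 'rV[R]_n)
                    (0 + (fun s : R => s *: h)).
  by apply: is_diffD.
have -> : (fun s : R => f (x + s *: h)) = f \o (cst x + (fun s : R => s *: h)).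
  by [].
have dfa : differentiable (f \o (cst x + (fun s : R => s *: h))) t.
  by apply: differentiable_comp.
split=> //; rewrite deriveE// diff_comp//=.
rewrite diff_val /= /GRing.zero/= /GRing.add/= scale1r add0r.
by rewrite -deriveE// deriveEjacobian.
Qed.

Lemma is_derive_dot_line (R : realType) (n m : nat) (f : 'rV[R]_n -> 'rV[R]_m)
    (e : 'rV[R]_m) (x h : 'rV[R]_n) (t : R) :
  differentiable f (x + t *: h) ->
  is_derive t 1 (fun s : R => dot e (f (x + s *: h)))
                (dot e (h *m 'J f (x + t *: h))).
Proof.
move=> /differentiable_line[dg Dg].
have der : derivable (fun s : R => f (x + s *: h)) t 1 by exact: diff_derivable.
have derj := (derivable_mxP _ _ _).1 der.
rewrite -Dg (derive_mx der).
have -> : (fun s : R => dot e (f (x + s *: h))) =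
    \sum_(j < m) (e ord0 j *: (fun s : R => f (x + s *: h) ord0 j)).
  by apply/funext => s; rewrite fct_sumE.
rewrite /dot; under [X in is_derive _ _ _ X]eq_bigr => j _ do rewrite mxE.
apply: is_derive_sum => j.
by apply: is_deriveZ; apply: derivableP; exact: derj.
Qed.

(** Mean value argument along the segment, applied to the scalar function [g]
    obtained by testing [f] against the defect [e] itself, so that no
    dimensional constant appears: with [g a - g 0 = a * g' s] and
    [g 1 - g 0 = g' r], the square of the norm of [e] is [a * (g' s - g' r)],
    and [g'] varies little because the derivative of [f] does. The factor [a]
    on the right is essential: the bound is later compared with [a] times the
    length of the segment. *)
Lemma interpolation_defect (R : realType) (n m : nat) (A : set 'rV[R]_n)
    (f : 'rV[R]_n -> 'rV[R]_m) (L : R) (x y : 'rV[R]_n) (a : R) :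
  (forall z, A z -> differentiable f z) ->
  0 <= L ->
  (forall z w, A z -> A w -> opnorm ('J f z - 'J f w) <= L * enorm (z - w)) ->
  (forall t : R, 0 <= t <= 1 -> A ((1 - t) *: x + t *: y)) ->
  0 <= a <= 1 ->
  enorm (f ((1 - a) *: x + a *: y) - ((1 - a) *: f x + a *: f y))
    <= a * (L * enorm (x - y) ^+ 2).
Proof.
have dist01 (s r : R) : 0 <= s <= 1 -> 0 <= r <= 1 -> `|s - r| <= 1.
  by move=> /andP[s0 s1] /andP[r0 r1]; rewrite ler_norml; lra.
move=> df L0 hL seg /andP[a0 a1].
have lineE (t : R) : (1 - t) *: x + t *: y = x + t *: (y - x).
  by rewrite scalerBl scale1r scalerBr -addrA [- _ + _]addrC.
set e := _ - _; set h := y - x.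
have [e0|e_neq0] := eqVneq (enorm e) 0.
  by rewrite e0 !mulr_ge0 ?exprn_ge0 ?enorm_ge0.
have e_gt0 : 0 < enorm e by rewrite lt_def e_neq0 enorm_ge0.
pose g (s : R) := dot e (f (x + s *: h)).
pose g' (s : R) := dot e (h *m 'J f (x + s *: h)).
have segA (t : R) : 0 <= t <= 1 -> A (x + t *: h) by rewrite -lineE; exact: seg.
have dg (t : R) : 0 <= t <= 1 -> is_derive t 1 g (g' t).
  by move=> /segA/df; exact: is_derive_dot_line.
have mvt (b : R) : 0 <= b <= 1 ->
    exists2 s : R, 0 <= s <= 1 & g b - g 0 = g' s * b.
  move=> /andP[b0 b1].
  have [||s] := @MVT_segment R g g' 0 b b0.
  - move=> t; rewrite in_itv/= => /andP[t0 tb].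
    by apply: dg; rewrite ltW// (le_trans (ltW tb)).
  - apply: derivable_within_continuous => t; rewrite in_itv/= => /andP[t0 tb].
    by have [] := dg t; rewrite ?t0 ?(le_trans tb).
  rewrite in_itv/= => /andP[s0 sb]; rewrite subr0 => ->.
  by exists s => //; rewrite s0 (le_trans sb).
have [|s s01 gs] := mvt a; first by rewrite a0.
have [|r r01 gr] := mvt 1; first by rewrite ler01 lexx.
have e2 : enorm e ^+ 2 = a * (g' s - g' r).
  have g0 : g 0 = dot e (f x) by rewrite /g scale0r addr0.
  have g1 : g 1 = dot e (f y) by rewrite /g scale1r /h addrCA subrr addr0.
  have ga : g a = dot e (f ((1 - a) *: x + a *: y)) by rewrite /g lineE.
  rewrite enorm_sqr {2}/e !(dotDr, dotNr, dotZr) -ga -g0 -g1.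
  by rewrite mulr1 in gr; rewrite mulrBr -gr [a * g' s]mulrC -gs; ring.
have hg : g' s - g' r <= enorm e * (L * enorm h ^+ 2).
  rewrite /g' -dotNr -dotDr -mulmxBr (le_trans (dot_le_enorm _ _))//.
  rewrite ler_wpM2l ?enorm_ge0// (le_trans (enorm_mulmx_le _ _))//.
  rewrite expr2 mulrA ler_wpM2r ?enorm_ge0//.
  rewrite (le_trans (hL _ _ (segA _ s01) (segA _ r01)))//.
  rewrite ler_wpM2l// opprD addrACA subrr add0r -scalerBl enormZ.
  by rewrite ler_piMl ?enorm_ge0// dist01.
rewrite -(ler_pM2l e_gt0) -expr2 e2 (enormBC x y) mulrCA.
by rewrite ler_wpM2l.
Qed.

(** * Projection onto a box *)

(** The extended real under [fine] is finite whenever [a < b], the case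
    [b = -oo] and the case [a = +oo] being then excluded. *)
Definition clamp (R : realType) (a b : \bar R) (x : R) : R :=
  fine (Order.max a (Order.min b x%:E)).

Lemma clamp_itv (R : realType) (a b : \bar R) (x : R) : (a < b)%E ->
  (a <= (clamp a b x)%:E)%E /\ ((clamp a b x)%:E <= b)%E.
Proof.
move=> ab; rewrite /clamp; case: (leP b x%:E) => bx.
  have b_fin : b \is a fin_num.
    by rewrite fin_numElt (le_lt_trans (leNye a) ab) (le_lt_trans bx) ?ltry.
  by rewrite (max_idPr (ltW ab)) fineK// lexx ltW.
case: (leP a x%:E) => ax; first by rewrite /= ax ltW.
have a_fin : a \is a fin_num.
  by rewrite fin_numElt (lt_le_trans ab (leey b)) (lt_trans _ ax) ?ltNyr.
by rewrite fineK// lexx ltW.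
Qed.

(** The variational inequality of the projection onto a closed interval. *)
Lemma clamp_obtuse (R : realType) (a b : \bar R) (x z : R) : (a < b)%E ->
  (a <= z%:E)%E -> (z%:E <= b)%E ->
  (x - clamp a b x) * (z - clamp a b x) <= 0.
Proof.
move=> ab az zb; rewrite /clamp; case: (leP b x%:E) => bx.
  have b_fin : b \is a fin_num.
    by rewrite fin_numElt (le_lt_trans (leNye a) ab) (le_lt_trans bx) ?ltry.
  rewrite (max_idPr (ltW ab)); move: bx zb; rewrite -{1 2}(fineK b_fin) !lee_fin.
  by move=> bx zb; rewrite mulr_ge0_le0 ?subr_ge0 ?subr_le0.
case: (leP a x%:E) => ax; first by rewrite /= subrr mul0r.
have a_fin : a \is a fin_num.
  by rewrite fin_numElt (lt_le_trans ab (leey b)) (lt_trans _ ax) ?ltNyr.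
move: ax az; rewrite -{1 2}(fineK a_fin) lte_fin lee_fin => /ltW ax az.
by rewrite mulr_le0_ge0 ?subr_ge0 ?subr_le0.
Qed.

(** Adding the variational inequalities at [x] and at [y] gives
    [(q - p)^2 <= (q - p) * (y - x)] for the images [p] of [x] and [q] of [y]. *)
Lemma clamp_incr (R : realType) (a b : \bar R) (x y : R) : (a < b)%E ->
  x <= y -> 0 <= clamp a b y - clamp a b x <= y - x.
Proof.
move=> ab xy.
have [ax bx] := clamp_itv x ab; have [ay yb] := clamp_itv y ab.
move: (clamp_obtuse x ab ay yb) (clamp_obtuse y ab ax bx).
move: (clamp a b x) (clamp a b y) {ab ax bx ay yb} => p q h2 h1.
have h : (q - p) * (q - p) <= (q - p) * (y - x).
  have -> : (q - p) * (y - x) = (q - p) * (q - p)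
    - (y - q) * (p - q) - (x - p) * (q - p) by ring.
  lra.
have qp : 0 <= q - p.
  by rewrite leNgt; apply/negP => qp; nra.
rewrite qp /=; have [qp0|qp_gt0] := eqVneq (q - p) 0; first by lra.
by rewrite -(@ler_pM2l _ (q - p))// lt_def qp_gt0.
Qed.

(** The increment of [clamp] from [x] to the intermediate point and the
    fraction [t] of its increment from [x] to [y] have the same sign, that of
    [y - x], and both are at most [t |x - y|] in absolute value; hence so is
    their difference, without a factor 2. *)
Lemma clamp_interpolation_defect (R : realType) (a b : \bar R) (x y t : R) :
  (a < b)%E -> 0 <= t <= 1 ->
  `|clamp a b ((1 - t) * x + t * y) - ((1 - t) * clamp a b x + t * clamp a b y)|
    <= t * `|x - y|.
Proof.
move=> ab /andP[t0 t1]; rewrite ler_norml.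
set w := _ + t * y.
case: (leP x y) => [xy|/ltW yx].
  have /andP[h1 h2] := clamp_incr ab xy.
  have xw : x <= w by clear -t0 t1 xy; rewrite /w; nra.
  have /andP[h3 h4] := clamp_incr ab xw; clear ab.
  have : w - x = t * (y - x) by rewrite /w; ring.
  have := ler_wpM2l t0 h1; have := ler_wpM2l t0 h2.
  rewrite ler0_norm ?subr_le0//; lra.
have /andP[h1 h2] := clamp_incr ab yx.
have wx : w <= x by clear -t0 t1 yx; rewrite /w; nra.
have /andP[h3 h4] := clamp_incr ab wx; clear ab.
have : x - w = t * (x - y) by rewrite /w; ring.
have := ler_wpM2l t0 h1; have := ler_wpM2l t0 h2.
rewrite ger0_norm ?subr_ge0//; lra.
Qed.

Definition clamp_row (R : realType) (l : nat) (lo hi : 'rV[\bar R]_l)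
    (w : 'rV[R]_l) : 'rV[R]_l :=
  \row_i clamp (lo ord0 i) (hi ord0 i) (w ord0 i).

Lemma clamp_row_box (R : realType) (l : nat) (lo hi : 'rV[\bar R]_l)
    (w : 'rV[R]_l) : (forall i, (lo ord0 i < hi ord0 i)%E) ->
  box lo hi (clamp_row lo hi w).
Proof. by move=> lohi i; rewrite mxE; exact: clamp_itv. Qed.

(** Summed over the coordinates, the variational inequality says that for [z] in
    the box the angle at [p] between [w] and [z] is not acute. The resulting
    Pythagorean inequality [pyth] gives both that [p] is nearest and that it is
    the only nearest point, as [xget] requires. *)
Lemma eproj_box (R : realType) (l : nat) (lo hi : 'rV[\bar R]_l)
    (w : 'rV[R]_l) : (forall i, (lo ord0 i < hi ord0 i)%E) ->
  eproj (box lo hi) w = clamp_row lo hi w.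
Proof.
move=> lohi; set p := clamp_row lo hi w.
have pyth z : box lo hi z ->
    enorm (w - p) ^+ 2 + enorm (p - z) ^+ 2 <= enorm (w - z) ^+ 2.
  move=> hz.
  have : dot (w - p) (z - p) <= 0.
    apply: sumr_le0 => i _; rewrite !mxE.
    by have [? ?] := hz i; exact: clamp_obtuse.
  have -> : w - z = (w - p) + (p - z) by rewrite addrA subrK.
  rewrite -(opprB p z) dotNr; move: (w - p) (p - z) {hz lohi} => s r.
  by rewrite !enorm_sqr !(dotDl, dotDr) (dotC r s); lra.
apply: xget_unique => [|q [qbox qmin]].
  split=> [|z hz]; first exact: clamp_row_box.
  rewrite -(@ler_pXn2r _ 2) ?nnegrE ?enorm_ge0//.
  by rewrite (le_trans _ (pyth z hz))// lerDl exprn_ge0 ?enorm_ge0.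
have := pyth q qbox; have := qmin p (clamp_row_box w lohi).
rewrite -(@ler_pXn2r _ 2) ?nnegrE ?enorm_ge0// => h1 h2.
have /eqP : enorm (p - q) ^+ 2 = 0.
  by apply/eqP; rewrite eq_le exprn_ge0 ?enorm_ge0// andbT; clear -h1 h2; lra.
by rewrite sqrf_eq0 => /eqP/enorm_eq0/eqP; rewrite subr_eq0 => /eqP.
Qed.

Lemma box_convex (R : realType) (l : nat) (lo hi : 'rV[\bar R]_l)
    (x y : 'rV[R]_l) (t : R) : 0 <= t <= 1 ->
  box lo hi x -> box lo hi y -> box lo hi ((1 - t) *: x + t *: y).
Proof.
move=> /andP[t0 t1] hx hy i; rewrite !mxE; have [lx xh] := hx i; have [ly yh] := hy i.
set a := x ord0 i in lx xh *; set b := y ord0 i in ly yh *.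
have [ab|/ltW ba] := leP a b.
  split; [apply: le_trans lx _|apply: le_trans _ yh]; rewrite lee_fin;
    clear -t0 t1 ab; nra.
split; [apply: le_trans ly _|apply: le_trans _ xh]; rewrite lee_fin;
  clear -t0 t1 ba; nra.
Qed.

Lemma clamp_row_nonexpansive (R : realType) (l : nat) (lo hi : 'rV[\bar R]_l)
    (x y : 'rV[R]_l) : (forall i, (lo ord0 i < hi ord0 i)%E) ->
  enorm (clamp_row lo hi x - clamp_row lo hi y) <= enorm (x - y).
Proof.
move=> lohi; apply: ler_enorm_coord => i; rewrite !mxE.
case: (leP (x ord0 i) (y ord0 i)) => [xy|/ltW yx].
  have /andP[h1 h2] := clamp_incr (lohi i) xy.
  by rewrite distrC (distrC (x _ _)) !ger0_norm// subr_ge0.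
have /andP[h1 h2] := clamp_incr (lohi i) yx.
by rewrite !ger0_norm// subr_ge0.
Qed.

Lemma clamp_row_interpolation_defect (R : realType) (l : nat)
    (lo hi : 'rV[\bar R]_l) (x y : 'rV[R]_l) (t : R) :
  (forall i, (lo ord0 i < hi ord0 i)%E) -> 0 <= t <= 1 ->
  enorm (clamp_row lo hi ((1 - t) *: x + t *: y)
         - ((1 - t) *: clamp_row lo hi x + t *: clamp_row lo hi y))
    <= t * enorm (x - y).
Proof.
move=> lohi t01; have /andP[t0 _] := t01.
have -> : t * enorm (x - y) = enorm (t *: (x - y)) by rewrite enormZ ger0_norm.
apply: ler_enorm_coord => i.
by rewrite !mxE normrM (ger0_norm t0) clamp_interpolation_defect.
Qed.

(** * The composite map *)

Lemma composite_lipschitz (R : realType) (n l : nat) (lo hi : 'rV[\bar R]_l)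
    (Q : 'rV[R]_n -> 'rV[R]_l) (H : 'rV[R]_l -> 'rV[R]_n)
    (G : 'rV[R]_n -> 'rV[R]_n) (D : set 'rV[R]_n) (DH : set 'rV[R]_l)
    (cQ cH : R) :
  (forall u, G u = H (eproj (box lo hi) (Q u))) ->
  (forall i, (lo ord0 i < hi ord0 i)%E) -> box lo hi `<=` DH ->
  lipschitz_cst D Q cQ -> lipschitz_cst DH H cH ->
  lipschitz_cst D G (cH * cQ).
Proof.
move=> GE lohi boxDH [cQ0 hQ] [cH0 hH]; split; first exact: mulr_ge0.
move=> x y Dx Dy; rewrite !GE !eproj_box//.
rewrite (le_trans (hH _ _ _ _))//; try by apply: boxDH; exact: clamp_row_box.
rewrite -mulrA ler_wpM2l// (le_trans (clamp_row_nonexpansive _ _ lohi))//.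
exact: hQ.
Qed.

(** The affine interpolant is moved through [Q], the projection and [H] one
    layer at a time. Moving it through [Q] and through [H] costs second order
    terms, collected in [K]. Only the projection contributes a first order term,
    at most [t * enorm (Q x - Q y)], which the Lipschitz constants of [Q] and
    [H] turn into [t * (cH * cQ * enorm (x - y))]. *)
Lemma composite_interpolation_defect (R : realType) (n l : nat)
    (lo hi : 'rV[\bar R]_l)
    (Q : 'rV[R]_n -> 'rV[R]_l) (H : 'rV[R]_l -> 'rV[R]_n)
    (G : 'rV[R]_n -> 'rV[R]_n) (D : set 'rV[R]_n) (DH : set 'rV[R]_l)
    (cQ cH : R) :
  (forall u, G u = H (eproj (box lo hi) (Q u))) ->
  (forall i, (lo ord0 i < hi ord0 i)%E) -> box lo hi `<=` DH ->
  C1_lipschitz D Q -> lipschitz_cst D Q cQ ->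
  C1_lipschitz DH H -> lipschitz_cst DH H cH ->
  exists2 K : R, 0 <= K & forall x y t,
    (forall s : R, 0 <= s <= 1 -> D ((1 - s) *: x + s *: y)) -> 0 <= t <= 1 ->
    enorm (G ((1 - t) *: x + t *: y) - ((1 - t) *: G x + t *: G y))
      <= t * ((cH * cQ + K * enorm (x - y)) * enorm (x - y)).
Proof.
move=> GE lohi boxDH [dQ _ [LQ [LQ0 hLQ]]] [cQ0 hQ] [dH _ [LH [LH0 hLH]]] [cH0 hH].
exists (cH * LQ + LH * cQ ^+ 2) => [|x y t seg t01].
  by rewrite addr_ge0// mulr_ge0// exprn_ge0.
have /andP[t0 t1] := t01.
rewrite !GE !eproj_box//; pose P := clamp_row lo hi.
rewrite -/(P _) -/(P (Q x)) -/(P (Q y)).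
have PDH w : DH (P w) by apply: boxDH; exact: clamp_row_box.
have Dx : D x by have := seg 0; rewrite subr0 scale1r scale0r addr0 lexx ler01; exact.
have Dy : D y by have := seg 1; rewrite subrr scale0r scale1r add0r lexx ler01; exact.
pose w := (1 - t) *: Q x + t *: Q y.
pose p := (1 - t) *: P (Q x) + t *: P (Q y).
have segP s : 0 <= s <= 1 -> DH ((1 - s) *: P (Q x) + s *: P (Q y)).
  by move=> s01; apply/boxDH/box_convex => //; exact: clamp_row_box.
have eQ : enorm (H (P (Q ((1 - t) *: x + t *: y))) - H (P w))
    <= cH * (t * (LQ * enorm (x - y) ^+ 2)).
  rewrite (le_trans (hH _ _ _ _))// ler_wpM2l//.
  rewrite (le_trans (clamp_row_nonexpansive _ _ lohi))//.
  exact: (interpolation_defect dQ).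
have eP : enorm (H (P w) - H p) <= cH * (t * (cQ * enorm (x - y))).
  rewrite (le_trans (hH _ _ _ _))//; first exact: segP.
  rewrite ler_wpM2l// (le_trans (clamp_row_interpolation_defect _ _ lohi t01))//.
  by rewrite ler_wpM2l// hQ.
have eH : enorm (H p - ((1 - t) *: H (P (Q x)) + t *: H (P (Q y))))
    <= t * (LH * (cQ * enorm (x - y)) ^+ 2).
  rewrite (le_trans (interpolation_defect dH LH0 hLH segP t01))//.
  rewrite ler_wpM2l// ler_wpM2l// lerXn2r ?nnegrE ?enorm_ge0 ?mulr_ge0 ?enorm_ge0//.
  by rewrite (le_trans (clamp_row_nonexpansive _ _ lohi))// hQ.
rewrite -(subrKA (H p)) (le_trans (ler_enormD _ _))//.
rewrite -(subrKA (H (P w))) (le_trans (lerD (ler_enormD _ _) (lexx _)))//.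
move: (lerD (lerD eQ eP) eH) => /le_trans; apply.
by rewrite le_eqVlt; apply/orP; left; apply/eqP; ring.
Qed.

(** * One step of the iteration *)

(** Comparison with the weight [0] gives the second claim. For the third,
    comparing [a] with the smaller weights [a * (1 - s)] gives the first order
    condition [a * dot F d + a^2 |d|^2 <= 0] for [d = E - F]. This holds even if
    [a = 1] is an active constraint, because only smaller weights are used; the
    bound then follows by Cauchy-Schwarz. *)
Lemma is_minimizer_mix (R : realType) (n : nat) (F E : 'rV[R]_n) (a : R) :
  is_minimizer `[0, 1] (fun b => enorm ((1 - b) *: F + b *: E)) a ->
  [/\ 0 <= a <= 1, enorm ((1 - a) *: F + a *: E) <= enorm F &
      a * enorm (E - F) <= enorm F].
Proof.
move=> [/=]; rewrite in_itv/= => /andP[a0 a1] amin; split; first by rewrite a0.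
  have /amin : `[0, 1]%classic (0 : R) by rewrite /= in_itv/= lexx ler01.
  by rewrite subr0 scale1r scale0r addr0.
set d := E - F; set y := a * dot F d + (a * enorm d) ^+ 2.
have y_le0 : y <= 0.
  rewrite leNgt; apply/negP => y_gt0.
  have phi b : enorm ((1 - b) *: F + b *: E) ^+ 2 =
      enorm F ^+ 2 + 2 * b * dot F d + b ^+ 2 * enorm d ^+ 2.
    have -> : (1 - b) *: F + b *: E = F + b *: d.
      by rewrite scalerBl scale1r /d scalerBr -addrA [- _ + _]addrC.
    rewrite enorm_sqr !(dotDl F, dotDr _ (b *: d)) (dotC _ F) !(dotZl, dotZr).
    by rewrite -!enorm_sqr; ring.
  have quad s : 0 < s <= 1 -> 2 * y <= s * (a * enorm d) ^+ 2.
    move=> /andP[s0 s1].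
    have : `[0, 1]%classic (a * (1 - s)).
      by rewrite /= in_itv/=; apply/andP; split; nra.
    move=> /amin; rewrite -(@ler_pXn2r _ 2) ?nnegrE ?enorm_ge0// !phi => h.
    rewrite -subr_ge0 -(pmulr_rge0 _ s0).
    by move: h; rewrite -subr_ge0; congr (_ <= _); rewrite /y; ring.
  set z := (a * enorm d) ^+ 2 in quad.
  have [zy|yz] := leP z y.
    by have := quad 1; rewrite ltr01 lexx mul1r => /(_ isT); lra.
  have z_gt0 : 0 < z by exact: lt_trans yz.
  (* For 0 < y < z the choice s = y / z turns the inequality into 2 y <= y. *)
  have := quad (y / z).
  by rewrite divr_gt0// ler_pdivrMr// mul1r ltW// divfK ?gt_eqF// => /(_ isT); lra.
have ad0 : 0 <= a * enorm d by rewrite mulr_ge0 ?enorm_ge0.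
have [->|ad_neq0] := eqVneq (a * enorm d) 0; first exact: enorm_ge0.
have ad_gt0 : 0 < a * enorm d by rewrite lt_def ad_neq0.
rewrite -(ler_pM2l ad_gt0) -expr2.
have := dot_le_enorm (- F) d; rewrite dotNl enormN => /(ler_wpM2l a0).
by move: y_le0; rewrite /y; lra.
Qed.

Lemma enorm_ball_convex (R : realType) (n : nat) (p x y : 'rV[R]_n) (r t : R) :
  0 <= t <= 1 -> enorm (x - p) <= r -> enorm (y - p) <= r ->
  enorm ((1 - t) *: x + t *: y - p) <= r.
Proof.
move=> t01 xr yr.
have -> : (1 - t) *: x + t *: y - p = (1 - t) *: (x - p) + t *: (y - p).
  by rewrite !scalerBr addrACA -opprD -scalerDl subrK scale1r.
rewrite (le_trans (ler_enorm_conv _ _ t01))//.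
by move: t01 => /andP[t0 t1]; nra.
Qed.

Lemma EDIIS1_ball (R : realType) (n : nat) (G : 'rV[R]_n -> 'rV[R]_n)
    (p u0 : 'rV[R]_n) (r : R) (u : nat -> 'rV[R]_n) :
  (forall x, enorm (x - p) <= r -> enorm (G x - p) <= r) ->
  enorm (u0 - p) <= r -> EDIIS1 G u0 u -> forall k, enorm (u k - p) <= r.
Proof.
move=> GB u0B [u00 u10 [alpha hu]] k.
suff : enorm (u k - p) <= r /\ enorm (u k.+1 - p) <= r by case.
elim: k => [|k [ukB uk1B]]; first by rewrite u00 u10; split=> //; exact: GB.
split=> //; have [//|/is_minimizer_mix[a01 _ _] ->] := hu k.+1.
by apply: enorm_ball_convex => //; exact: GB.
Qed.

(** The new residual splits at [G v], with [v] the mixture of the old points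
    themselves. The number [e] stands for the second order part of the
    interpolation defect, which is small for nearby [x] and [y]. *)
Lemma mix_residual_le (R : realType) (n : nat) (G : 'rV[R]_n -> 'rV[R]_n)
    (D : set 'rV[R]_n) (x y : 'rV[R]_n) (a c e : R) :
  lipschitz_cst D G c -> c < 1 -> 0 <= e ->
  (forall s : R, 0 <= s <= 1 -> D ((1 - s) *: x + s *: y)) ->
  is_minimizer `[0, 1]
    (fun b => enorm ((1 - b) *: residual G x + b *: residual G y)) a ->
  let x' := (1 - a) *: G x + a *: G y in
  D x' ->
  enorm (G ((1 - a) *: x + a *: y) - x') <= a * ((c + e) * enorm (x - y)) ->
  enorm (residual G x') <= (c + (c + e) / (1 - c)) * enorm (residual G x).
Proof.
move=> [c0 Glip] c1 e0 seg /is_minimizer_mix[a01 mixF adF] x' Dx' defect.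
have /andP[a0 a1] := a01.
have Dx : D x by have := seg 0; rewrite subr0 scale1r scale0r addr0 lexx ler01; exact.
have Dy : D y by have := seg 1; rewrite subrr scale0r scale1r add0r lexx ler01; exact.
set v := (1 - a) *: x + a *: y in defect.
have stepA : enorm (G x' - G v) <= c * enorm (residual G x).
  rewrite (le_trans (Glip _ _ Dx' (seg a a01)))// ler_wpM2l//.
  have -> : x' - v = (1 - a) *: residual G x + a *: residual G y.
    by rewrite /x' /v /residual !scalerBr addrACA -opprD.
  exact: mixF.
have lower : (1 - c) * enorm (x - y) <= enorm (residual G y - residual G x).
  have -> : residual G y - residual G x = (x - y) - (G x - G y).
    by apply/rowP => i; rewrite !mxE; ring.
  by have := ler_enormB (x - y) (G x - G y); have := Glip _ _ Dx Dy; lra.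
have stepB : enorm (G v - x') <= (c + e) / (1 - c) * enorm (residual G x).
  rewrite (le_trans defect)// mulrCA -mulrA ler_wpM2l ?addr_ge0//.
  rewrite ler_pdivlMl ?subr_gt0// (le_trans _ adF)//.
  by rewrite mulrCA ler_wpM2l.
rewrite /residual -(subrKA (G v)) (le_trans (ler_enormD _ _))// mulrDl.
exact: lerD.
Qed.

(** * Local linear convergence *)

(* lo ord0 i < hi ord0 i excludes lo ord0 i = +oo and hi ord0 i = -oo. *)
Theorem corollary2p2 (R : realType) (n l : nat)
    (lo hi : 'rV[\bar R]_l) (hlohi : forall i, (lo ord0 i < hi ord0 i)%E)
    (Q : 'rV[R]_n -> 'rV[R]_l) (H : 'rV[R]_l -> 'rV[R]_n)
    (G : 'rV[R]_n -> 'rV[R]_n)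
    (hG : forall u, G u = H (eproj (box lo hi) (Q u)))
    (D : set 'rV[R]_n) (hDclosed : closed D) (hGD : G @` D `<=` D)
    (DH : set 'rV[R]_l) (hDHopen : open DH) (hDH : box lo hi `<=` DH)
    (cQ cH c : R)
    (hQ : C1_lipschitz D Q) (hcQ : lipschitz_cst D Q cQ)
    (hH : C1_lipschitz DH H) (hcH : lipschitz_cst DH H cH)
    (hc : c = cH * cQ) (hc1 : c < 1)
    (ustar : 'rV[R]_n) (hustarD : D ustar) (hustar : G ustar = ustar)
    (delta : R) (hdelta : 0 < delta)
    (hball : [set u | enorm (u - ustar) <= delta] `<=` D)
    (cbar : R) (hcbar : cbar = (2 * c - c ^+ 2) / (1 - c)) (hcbar1 : cbar < 1) :
  forall chat : R, cbar < chat -> chat < 1 ->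
  exists delta0 : R, 0 < delta0 /\
    forall u0 : 'rV[R]_n, D u0 -> enorm (u0 - ustar) <= delta0 ->
    forall u : nat -> 'rV[R]_n, EDIIS1 G u0 u ->
    forall k : nat,
      enorm (residual G (u k.+1)) <= chat * enorm (residual G (u k)).
Proof.
move=> chat cbar_chat _.
have := composite_lipschitz hG hlohi hDH hcQ hcH; rewrite -hc => Glip.
have [K K0] := composite_interpolation_defect hG hlohi hDH hQ hcQ hH hcH.
rewrite -hc => Gdefect.
have [c0 Gc] := Glip.
have c1 : 0 < 1 - c by rewrite subr_gt0.
have gap : 0 < (chat - cbar) * (1 - c) by rewrite mulr_gt0// subr_gt0.
(* The second bound makes K * (2 * delta0) fit in the gap between cbar and
   chat; the summand 1 keeps the denominator positive when K = 0. *)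
pose delta0 := Num.min delta ((chat - cbar) * (1 - c) / (2 * K + 1)).
have K1 : 0 < 2 * K + 1 by lra.
have d0_gt0 : 0 < delta0 by rewrite lt_min hdelta divr_gt0.
have d0_gap : K * (2 * delta0) <= (chat - cbar) * (1 - c).
  have : delta0 <= (chat - cbar) * (1 - c) / (2 * K + 1).
    by rewrite ge_min lexx orbT.
  by rewrite ler_pdivlMr//; nra.
have ballD x : enorm (x - ustar) <= delta0 -> D x.
  by move=> xd; apply: hball; rewrite /= (le_trans xd)// ge_min lexx.
have Gball x : enorm (x - ustar) <= delta0 -> enorm (G x - ustar) <= delta0.
  move=> xd; rewrite -hustar (le_trans (Gc _ _ (ballD x xd) hustarD))//.
  by rewrite (le_trans _ xd)// ler_piMl ?enorm_ge0// ltW.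
exists delta0; split=> // u0 _ u0B u hu.
have uB := EDIIS1_ball Gball u0B hu.
have [u00 u10 [alpha ha]] := hu.
have cbarE : cbar = c + c / (1 - c).
  by rewrite hcbar; field; rewrite gt_eqF.
case=> [|k].
  rewrite u10 u00.
  rewrite (le_trans (Gc _ _ (ballD _ (Gball _ u0B)) (ballD _ u0B)))//.
  rewrite ler_wpM2r ?enorm_ge0// ltW// (le_lt_trans _ cbar_chat)// cbarE.
  by rewrite lerDl divr_ge0// ltW.
have [//|amin uE] := ha k.+1.
have seg (s : R) : 0 <= s <= 1 -> D ((1 - s) *: u k.+1 + s *: u k).
  by move=> s01; apply: ballD; exact: enorm_ball_convex.
have [a01 _ _] := is_minimizer_mix amin; have /andP[a0 _] := a01.
have defect := Gdefect _ _ _ seg a01.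
rewrite uE /=.
have uu : enorm (u k.+1 - u k) <= 2 * delta0.
  rewrite -(subrKA ustar) (le_trans (ler_enormD _ _))// (enormBC ustar).
  by have := uB k.+1; have := uB k; lra.
have := @mix_residual_le _ _ G D (u k.+1) (u k) (alpha k.+1) c
  (K * enorm (u k.+1 - u k)) Glip hc1 _ seg amin _ defect.
rewrite mulr_ge0 ?enorm_ge0// => /(_ isT) h.
apply: le_trans (h _) _; first by rewrite -[_ + _]uE; exact/ballD/uB.
rewrite ler_wpM2r ?enorm_ge0// mulrDl addrA -cbarE -lerBrDl.
by rewrite ler_pdivrMr// (le_trans _ d0_gap)// ler_wpM2l.
Qed.
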